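(* Let $\alpha$ be a special Pisot unit, $\beta=\alpha/(\alpha-1)$, such that $\alpha^q=\beta$ holds for an integer $q\ge2$ (i.e. $q\in\{2,3,4,5\}$). Let $\theta_q$ be the substitution over $\mathcal{A}=\{0,\dots,2q-1\}$ given by $$k\mapsto k+1\ (0\le k\le q-2),\quad (q-1)\mapsto q\,(q-1),\quad k\mapsto k+1\ (q\le k\le 2q-2),\quad (2q-1)\mapsto(2q-1)\,0.$$ For $k\in\mathcal{A}$ define $$X_k=\begin{cases}\psi(\alpha^k)-f_L^k\circ f_R(\mathcal{F}_\alpha), & k\in\{0,\dots,q-2\};\\ \psi(\alpha^{q-1})-f_L^{q-1}(\mathcal{F}_\alpha), & k=q-1;\\ f_L^{k-q}\circ f_R(\mathcal{F}_\alpha), & k\in\{q,\dots,2q-2\};\\ f_L^{q-1}(\mathcal{F}_\alpha), & k=2q-1.\end{cases}$$ Then $\theta_q$ is a primitive unimodular Pisot substitution with dominant root $\alpha$, and $\mathcal{R}_{\theta_q}(k)\cong X_k$ for each $k\in\mathcal{A}$.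
   Context: Tent-tiles. A Pisot number is an algebraic integer that is a real number $>1$ whose other Galois conjugates have modulus $<1$. A special Pisot unit is a Pisot number $\alpha$ that is an algebraic unit and for which $\beta=\alpha/(\alpha-1)$ is also a Pisot number. Let $d+1$ be the degree of $\alpha$, with further real conjugates $\alpha^{(1)},\dots,\alpha^{(r)}$ and non-real conjugates $\alpha^{(r+1)},\overline{\alpha^{(r+1)}},\dots,\alpha^{(r+s)},\overline{\alpha^{(r+s)}}$. Put $\mathbb{K}_\alpha=\mathbb{R}^r\times\mathbb{C}^s$; for $z\in\mathbb{Q}(\alpha)$ let $z^{(k)}$ be its image under $\alpha\mapsto\alpha^{(k)}$, $\psi(z)=(z^{(1)},\dots,z^{(r+s)})^T$, and $\Psi[z](x_1,\dots,x_{r+s})=(z^{(1)}x_1,\dots,z^{(r+s)}x_{r+s})^T$. Put $f_L(x)=\Psi[\alpha](x)$, $f_R(x)=\Psi[\beta](\psi(1)-x)$. The tent-tile $\mathcal{F}_\alpha$ is the unique non-empty compact set with $\mathcal{F}_\alpha=f_L(\mathcal{F}_\alpha)\cup f_R(\mathcal{F}_\alpha)$. Powers $f_L^k$ denote iterates; for a set $F$, $c-F=\{c-y:y\in F\}$. Rauzy fractals. Let $\mathcal{A}=\{0,\dots,m\}$ and $\mathcal{A}^*$ the free monoid of finite words over $\mathcal{A}$ (empty word $\varepsilon$). For $W\in\mathcal{A}^*$ let $\ell(W)=(|W|_0,\dots,|W|_m)^T$ count letter occurrences. A substitution $\zeta$ is a non-erasing endomorphism of $\mathcal{A}^*$; its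 incidence matrix $M_\zeta$ has columns $\ell(\zeta(0)),\dots,\ell(\zeta(m))$. It is primitive if some power $\zeta^k$ ($k\ge1$) has all entries of $\ell(\zeta^k(a))$ positive for every $a\in\mathcal{A}$. For primitive $\zeta$, the dominant root $\lambda$ is the Perron–Frobenius eigenvalue of $M_\zeta$; $\zeta$ is unimodular if $\det M_\zeta=\pm1$ and Pisot if $\lambda$ is a Pisot number. Let $\nu$ be a left eigenvector of $M_\zeta$ for $\lambda$ with strictly positive entries in $\mathbb{Q}(\lambda)$. With the conjugates of $\lambda$ different from $\lambda$ being real $\lambda^{(1)},\dots,\lambda^{(r)}$ and non-real $\lambda^{(r+1)},\overline{\lambda^{(r+1)}},\dots,\lambda^{(r+s)},\overline{\lambda^{(r+s)}}$, put $\mathbb{K}_\zeta=\mathbb{R}^r\times\mathbb{C}^s$, $\pi(z)=(z^{(1)},\dots,z^{(r+s)})^T$ for $z\in\mathbb{Q}(\lambda)$ (images under $\lambda\mapsto\lambda^{(k)}$), $h(x_1,\dots,x_{r+s})=(\lambda^{(1)}x_1,\dots,\lambda^{(r+s)}x_{r+s})^T$, and for $U\in\mathcal{A}^*$, $g_U(x)=\pi(\langle\nu,\ell(U)\rangle)+h(x)$. The sets $\mathcal{R}_\zeta(a)$, $a\in\mathcal{A}$, are the unique non-empty compact subsets of $\mathbb{K}_\zeta$ with $$\mathcal{R}_\zeta(a)=\bigcup_{(b,U,V):\ \zeta(b)=UaV} g_U(\mathcal{R}_\zeta(b))\qquad(a\in\mathcal{A},\ b\in\mathcal{A},\ U,V\in\mathcal{A}^*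 ).$$ They are determined up to a linear isomorphism (depending on the choice of $\nu$ and of the ordering of conjugates). Here ''$\mathcal{R}_\zeta(k)\cong X_k$ for each $k$'' means: there is a linear bijection $\Phi:\mathbb{K}_\alpha\to\mathbb{K}_\zeta$, the same for all $k\in\mathcal{A}$, with $\mathcal{R}_\zeta(k)=\Phi(X_k)$. *)

(* Defs.v *)
From mathcomp Require Export all_boot all_order all_algebra.
From mathcomp Require Export all_classical all_reals topology normedtype.
From mathcomp Require Export complex.

Set Implicit Arguments.
Unset Strict Implicit.
Unset Printing Implicit Defensive.

Import Order.TTheory GRing.Theory Num.Theory.
Import numFieldNormedType.Exports.

Local Open Scope classical_set_scope.
Local Open Scope ring_scope.
Local Open Scope complex_scope.

Section Pisot.
Variable R : realType.
Implicit Types a z lam : R.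

(* p is the minimal polynomial of a over the rationals. *)
Definition is_minpoly (p : {poly rat}) a : Prop :=
  [/\ p \is monic, irreducible_poly p & root (map_poly ratr p) a].

Definition galois_conjugate a (w : R[i]) : Prop :=
  exists2 p, is_minpoly p a & root (map_poly ratr p) w.

Definition alg_integer a : Prop := integralOver (intr : int -> R) a.

Definition alg_unit a : Prop :=
  [/\ a != 0, alg_integer a & alg_integer a^-1].

(* The norm of R[i] takes its values in R[i]. *)
Definition pisot a : Prop :=
  [/\ alg_integer a, 1 < a &
      forall w, galois_conjugate a w -> w != a%:C -> `|w| < 1].

Definition special_pisot_unit a : Prop :=
  [/\ pisot a, alg_unit a & pisot (a / (a - 1))].

(* rs lists the real conjugates of a other than a, and cs contains one member
   of each pair of non-real complex-conjugate conjugates of a. *)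
Definition conj_enum a (rs : seq R) (cs : seq R[i]) : Prop :=
  let ws := [seq x%:C | x <- rs] ++ cs ++ [seq conjc w | w <- cs] in
  [/\ uniq ws,
      all (fun w => complex.Im w != 0) cs &
      forall w, w \in ws <-> galois_conjugate a w /\ w != a%:C].

(* For algebraic a, these are all the elements of the field Q(a). *)
Definition in_Qadj a z : Prop :=
  exists p : {poly rat}, z = (map_poly ratr p).[a].

(* For z = p(a) with p rational, conj_img a b z = p(b). When b is a conjugate
   of a this does not depend on p (conj_imgE below), so that conj_img a b is
   the field embedding of Q(a) that sends a to b. *)
Definition conj_img (F : numFieldType) a (b : F) z : F :=
  (map_poly ratr
     (xget 0 [set p : {poly rat} | (map_poly ratr p).[a] = z])).[b].

Lemma conj_imgE (F : numFieldType) a (b : F) (m p : {poly rat}) :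
  is_minpoly m a -> root (map_poly ratr m) b ->
  conj_img a b (map_poly ratr p).[a] = (map_poly ratr p).[b].
Proof.
case=> _ irr_m ma mb; rewrite /conj_img.
set S := [set _ | _]; set p' := xget _ _.
have /= p'a : S p' by exact: (xgetPex 0 (ex_intro S p erefl)).
apply/eqP; rewrite -subr_eq0 -hornerN -hornerD -rmorphN -rmorphD -rootE.
suff /dvdpP[u ->] : m %| p' - p by rewrite rmorphM rootM mb orbT.
have ncop : ~~ coprimep m (p' - p).
  apply/negP; rewrite -(coprimep_map (ratr : {rmorphism rat -> R})).
  move=> /coprimep_root /(_ ma); rewrite rmorphB hornerD hornerN p'a subrr.
  by rewrite eqxx.
have /andP[_ m_gcd] := irr_m.2 _ ncop (dvdp_gcdl m (p' - p)).
exact: dvdp_trans m_gcd (dvdp_gcdr _ _).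
Qed.

End Pisot.

Section ConjugateSpace.
Variable R : realType.

(* K R r s is R^r x C^s with the product topology; R[i]^o is the field R[i]
   with the topology of its norm. *)
Definition K (r s : nat) := ('rV[R]_r * 'rV[R[i]^o]_s)%type.

Definition scaleK r s (c : R) (x : K r s) : K r s := (c *: x.1, c%:C *: x.2).

Definition linearK r s r' s' (Phi : K r s -> K r' s') : Prop :=
  forall c x y, Phi (scaleK c x + y) = scaleK c (Phi x) + Phi y.

Section Embeddings.
Variables (a : R) (r s : nat) (rs : r.-tuple R) (cs : s.-tuple R[i]).

Definition psi (z : R) : K r s :=
  (\row_i conj_img a (tnth rs i) z, \row_j conj_img a (tnth cs j) z).

Definition Psi (z : R) (x : K r s) : K r s :=
  (\row_i (conj_img a (tnth rs i) z * x.1 0 i),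
   \row_j (conj_img a (tnth cs j) z * x.2 0 j)).

Definition conj_mul (x : K r s) : K r s :=
  (\row_i (tnth rs i * x.1 0 i), \row_j (tnth cs j * x.2 0 j)).

End Embeddings.
End ConjugateSpace.

Section TentTile.
Variables (R : realType) (a : R) (r s : nat).
Variables (rs : r.-tuple R) (cs : s.-tuple R[i]).

Definition fL (x : K R r s) : K R r s := Psi a rs cs a x.

Definition fR (x : K R r s) : K R r s :=
  Psi a rs cs (a / (a - 1)) (psi a rs cs 1 - x).

Definition tent_tile (F : set (K R r s)) : Prop :=
  [/\ F !=set0, compact F & F = fL @` F `|` fR @` F].

Definition X_ (q : nat) (F : set (K R r s)) (k : 'I_(2 * q)) : set (K R r s) :=
  if (k < q - 1)%N then
    [set psi a rs cs (a ^+ k) - y | y in (iter k fL \o fR) @` F]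
  else if (k == q - 1 :> nat)%N then
    [set psi a rs cs (a ^+ (q - 1)) - y | y in iter (q - 1) fL @` F]
  else if (k < 2 * q - 1)%N then (iter (k - q) fL \o fR) @` F
  else iter (q - 1) fL @` F.

End TentTile.

(* A substitution is given by the images of the letters. *)
Section Substitution.
Variables (m : nat) (zeta : 'I_m -> seq 'I_m).

Definition nonerasing : Prop := forall b, zeta b != [::].

Definition subst_word (w : seq 'I_m) : seq 'I_m := flatten (map zeta w).

Definition primitive : Prop :=
  exists2 k, (0 < k)%N &
    forall a b, (0 < count_mem b (iter k subst_word [:: a]))%N.

Definition incidence (A : pzRingType) : 'M[A]_m :=
  \matrix_(a, b) (count_mem a (zeta b))%:R.

Definition unimodular : Prop :=
  \det (incidence int) = 1 \/ \det (incidence int) = -1.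

Variable R : realType.
Implicit Types lam : R.

(* The Perron-Frobenius eigenvalue: the positive eigenvalue that exceeds all
   other complex eigenvalues in modulus. *)
Definition dominant_root lam : Prop :=
  [/\ 0 < lam, eigenvalue (incidence R) lam &
      forall w : R[i], eigenvalue (incidence R[i]) w -> w != lam%:C ->
        `|w| < lam%:C].

Definition pisot_subst : Prop := exists2 lam, dominant_root lam & pisot lam.

Definition PF_left_eigenvector lam (nu : 'rV[R]_m) : Prop :=
  [/\ nu *m incidence R = lam *: nu, forall a, 0 < nu 0 a &
      forall a, in_Qadj lam (nu 0 a)].

Variables (lam : R) (nu : 'rV[R]_m) (r s : nat).
Variables (rs : r.-tuple R) (cs : s.-tuple R[i]).

Definition gmap (U : seq 'I_m) (x : K R r s) : K R r s :=
  psi lam rs cs (\sum_a nu 0 a * (count_mem a U)%:R) + conj_mul rs cs x.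

Definition rauzy_family (Rz : 'I_m -> set (K R r s)) : Prop :=
  forall a, [/\ Rz a !=set0, compact (Rz a) &
    Rz a = \bigcup_(t in [set t : 'I_m * seq 'I_m * seq 'I_m |
                           zeta t.1.1 = t.1.2 ++ a :: t.2])
             gmap t.1.2 @` Rz t.1.1].

End Substitution.

(* ordS is the cyclic successor: it sends 2q - 1 to 0. *)
Definition theta (q : nat) (k : 'I_(2 * q)) : seq 'I_(2 * q) :=
  if (k == q - 1 :> nat)%N then [:: ordS k; k]
  else if (k == 2 * q - 1 :> nat)%N then [:: k; ordS k]
  else [:: ordS k].

(* Main.v *)
Require Import Defs.
From mathcomp Require Import sequences zify ring.

(* Since alpha^q = alpha / (alpha - 1), we have alpha^(q-1) (alpha - 1) = 1, while
   every eigenvalue w of the incidence matrix satisfies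
   (w^(q-1) (w - 1))^2 = 1. If |w| >= alpha, then |w - 1| >= alpha - 1, and the
   product of the two moduli forces w = alpha.

   The positive left eigenvectors over Q(alpha) are
   c (1, alpha, ..., alpha^(q-1), 1, alpha, ..., alpha^(q-1)). Each X_k is an
   affine image of the tent-tile F; substituting F = f_L(F) u f_R(F) in X_(q-1)
   and X_(2q-1), the only two letters with two occurrences in the images of
   theta, turns the Rauzy equations into identities in Q(alpha). They
   hold for the map that multiplies by the conjugates of - c (and matches the two
   enumerations of the conjugates). As multiplication by the conjugates of alpha
   is a contraction, the Rauzy equations have at most one solution. *)

Set Implicit Arguments.
Unset Strict Implicit.
Unset Printing Implicit Defensive.

Import Order.TTheory GRing.Theory Num.Theory.
Import numFieldNormedType.Exports.
Local Open Scope classical_set_scope.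
Local Open Scope ring_scope.
Local Open Scope complex_scope.

(** * The substitution and its incidence matrix *)

Section Substitutions.
Variables (m : nat) (zeta : 'I_m -> seq 'I_m).

(** Both the products v M and the weights of prefixes in [gmap] are sums over counted letters;
    summing along the word instead makes them computable on the short images of [theta]. *)
Lemma sum_count_mem (A : pzRingType) (f : 'I_m -> A) (w : seq 'I_m) :
  \sum_a f a * (count_mem a w)%:R = \sum_(c <- w) f c.
Proof.
elim: w => [|c w IHw]; first by rewrite big_nil big1 // => a _; rewrite mulr0.
rewrite big_cons -IHw /= [in RHS](eq_bigr (fun a => f a * (count_mem a w)%:R))//.
rewrite (eq_bigr (fun a => f a * (c == a)%:R + f a * (count_mem a w)%:R)).
  rewrite big_split /= (bigD1 c) //= eqxx mulr1 big1 ?addr0// => a.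
  by rewrite eq_sym => /negPf ->; rewrite mulr0.
by move=> a _; rewrite natrD mulrDr.
Qed.

Lemma mul_incidence (A : pzRingType) (v : 'rV[A]_m) (b : 'I_m) :
  (v *m incidence zeta A) 0 b = \sum_(c <- zeta b) v 0 c.
Proof.
by rewrite mxE -sum_count_mem; apply: eq_bigr => a _; rewrite mxE.
Qed.

(** A path in the graph of letters, with f choosing the next letter inside each image, gives an
    occurrence in the iterated word. *)
Lemma mem_iter_subst_word (n : nat) (f : 'I_m -> 'I_m) (a : 'I_m) (w : seq 'I_m) :
  (forall b, f b \in zeta b) -> a \in w ->
  iter n f a \in iter n (subst_word zeta) w.
Proof.
move=> fP aw; elim: n => //= n IHn.
by apply/flatten_mapP; exists (iter n f a).
Qed.

End Substitutions.

Section Theta.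
Variable q : nat.
Hypothesis q_ge2 : (2 <= q)%N.
Let theta := @theta q.

Lemma iter_ordS_val (n j : nat) (a : 'I_n) :
  iter j (@ordS n) a = ((a + j) %% n)%N :> nat.
Proof.
elim: j => [|j IHj] /=; first by rewrite addn0 modn_small.
by rewrite IHj addnS -addn1 modnDml addn1.
Qed.

Lemma mem_ordS_theta (b : 'I_(2 * q)) : ordS b \in theta b.
Proof.
by rewrite /theta /Defs.theta; do 2?[case: ifP => _]; rewrite !inE eqxx ?orbT.
Qed.

Lemma nonerasing_theta : nonerasing theta.
Proof. by move=> b; have := mem_ordS_theta b; case: (theta b). Qed.

Lemma primitive_theta : primitive theta.
Proof.
exists (4 * q)%N => [|a b]; first by lia.
have q2 : (q - 1 < 2 * q)%N by lia.
(* Follow the cycle from a to the letter l, wait on its loop, then go on to b. *)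
pose l := Ordinal q2.
have loop : l \in theta l by rewrite /theta /Defs.theta eqxx !inE eqxx orbT.
rewrite -has_count has_pred1.
(* The distances along the cycle from a to q - 1 and from q - 1 to b, each increased by 2q to stay
   in [nat]; [e1] and [e2] are their reductions modulo 2q. *)
pose d1 := (q - 1 + (2 * q - a))%N.
pose d2 := (b + (q + 1))%N.
have [la lb] := (ltn_ord a, ltn_ord b).
pose e1 := if (d1 < 2 * q)%N then d1 else (d1 - 2 * q)%N.
pose e2 := if (d2 < 2 * q)%N then d2 else (d2 - 2 * q)%N.
have e1q : (e1 < 2 * q)%N by rewrite /e1 /d1; case: ifP; lia.
have e2q : (e2 < 2 * q)%N by rewrite /e2 /d2; case: ifP; lia.
have al : iter e1 (@ordS _) a = l.
  apply: val_inj; rewrite /= iter_ordS_val /e1 /d1; case: ifP => H.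
    have -> : (a + (q - 1 + (2 * q - a)) = 2 * q + (q - 1))%N by lia.
    by rewrite modnDl modn_small.
  have -> : (a + (q - 1 + (2 * q - a) - 2 * q) = (q - 1))%N by lia.
  by rewrite modn_small.
have lbE : iter e2 (@ordS _) l = b.
  apply: val_inj; rewrite /= iter_ordS_val /e2 /d2 /=; case: ifP => H.
    have -> : (q - 1 + (b + (q + 1)) = 2 * q + b)%N by lia.
    by rewrite modnDl modn_small.
  have -> : (q - 1 + (b + (q + 1) - 2 * q) = b)%N by lia.
  by rewrite modn_small.
(* Both legs are shorter than 2q, so 4q serves all pairs a, b, and the remaining steps are spent on
   the loop. *)
have -> : (4 * q = e2 + ((4 * q - e1 - e2) + e1))%N by lia.
rewrite !iterD -lbE.
apply: mem_iter_subst_word => //; first exact: mem_ordS_theta.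
have stay n (w : seq 'I_(2 * q)) : l \in w -> l \in iter n (subst_word theta) w.
  move=> lw; elim: n => //= n IHn.
  by apply/flatten_mapP; exists l.
apply: stay; rewrite -al; apply: mem_iter_subst_word; rewrite ?inE //.
exact: mem_ordS_theta.
Qed.

(** An integer matrix with an integer left inverse has an invertible determinant, and the only units
    of [int] are 1 and -1. *)
Lemma unimodular_theta : unimodular theta.
Proof.
pose sp (b : 'I_(2 * q)) := (b == q - 1 :> nat)%N || (b == 2 * q - 1 :> nat)%N.
(* The incidence matrix is a cyclic shift plus a loop at the two letters b with
   sp b; these are not adjacent, so the inverse N of the incidence matrix is the
   inverse shift with a correction of first order only. *)
pose N : 'M[int]_(2 * q) :=
  \matrix_(i, a) ((ordS i == a)%:R - (sp (ordS i) && (ordS (ordS i) == a))%:R).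
have sp_ordS b : sp b -> ~~ sp (ordS b).
  rewrite /sp => /orP[] /eqP b_eq; rewrite /= b_eq.
    by rewrite modn_small; lia.
  by rewrite subn1 prednK ?modnn; lia.
have sum_theta (f : 'I_(2 * q) -> int) b :
    \sum_(c <- theta b) f c = f (ordS b) + (sp b)%:R * f b.
  rewrite /theta /Defs.theta /sp; case: ifP => b1.
    by rewrite big_cons big_seq1 mul1r.
  case: ifP => b2; first by rewrite big_cons big_seq1 mul1r addrC.
  by rewrite big_seq1 mul0r addr0.
have NM : N *m incidence theta int = 1%:M.
  apply/matrixP => i b; rewrite mxE.
  rewrite (eq_bigr (fun a => N i a * (count_mem a (theta b))%:R)); last first.
    by move=> a _; rewrite [incidence _ _ _ _]mxE.
  rewrite sum_count_mem sum_theta !mxE.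
  rewrite !(inj_eq (can_inj (@ordSK _))).
  have [ib|ib] := eqVneq (ordS i) b.
    rewrite !ib; case: (boolP (sp b)) => [sp_b|_] /=; last first.
      by rewrite mul0r subr0 addr0.
    have -> : (ordS b == b) = false.
      by apply/negP => /eqP bb; have := sp_ordS _ sp_b; rewrite bb sp_b.
    by rewrite mul1r subr0 subrK.
  rewrite andbF subr0 sub0r; case: (boolP (sp b)) => [sp_b|_] /=; last first.
    by rewrite mul0r addr0.
  have -> : sp (ordS i) && (ordS (ordS i) == b) = false.
    apply/negP => /andP[/sp_ordS /negP sp_i /eqP ib'].
    by apply: sp_i; rewrite ib'.
  by rewrite oppr0 mulr0 addr0.
have [_] := mulmx1_unit NM; rewrite unitmxE.
by rewrite /unimodular; case/orP => /eqP ->; [left | right].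
Qed.

(** The eigenvalue equations are solved along the cycle from the letter 0, passed as z. Each step
    multiplies by w, except that leaving q - 1 or 2q - 1 multiplies by w - 1. One half of the cycle
    thus gives the factor c, and closing the cycle gives c^2. A general ring covers both complex
    eigenvalues and real eigenvectors. *)
Lemma theta_eigenE (A : comPzRingType) (w : A) (v : 'I_(2 * q) -> A)
    (z : 'I_(2 * q)) (c := w ^+ (q - 1) * (w - 1)) :
  z = 0%N :> nat -> (forall b, \sum_(a <- theta b) v a = w * v b) ->
  c ^+ 2 * v z = v z /\
  forall b, v b = if (b < q)%N then w ^+ b * v z else w ^+ (b - q) * c * v z.
Proof.
move=> z0 vE.
have step (b a : 'I_(2 * q)) : (b != q - 1 :> nat)%N ->
    (b != 2 * q - 1 :> nat)%N ->
    a = b.+1 :> nat -> v a = w * v b.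
  move=> b1 b2 ab; rewrite -vE /theta /Defs.theta (negPf b1) (negPf b2) big_seq1.
  by congr v; apply: val_inj => /=; rewrite modn_small //; have := ltn_ord a; lia.
have lo n (b : 'I_(2 * q)) : b = n :> nat -> (n < q)%N -> v b = w ^+ n * v z.
  elim: n b => [|n IHn] b bn nq.
    by rewrite mul1r; congr v; apply: val_inj; rewrite /= bn.
  have n2 : (n < 2 * q)%N by lia.
  rewrite exprS -mulrA -(IHn (Ordinal n2)) //; last by lia.
  by apply: step => //=; lia.
have q2 : (q - 1 < 2 * q)%N by lia.
have q3 : (q < 2 * q)%N by lia.
have q4 : (2 * q - 1 < 2 * q)%N by lia.
have mid : v (Ordinal q3) = c * v z.
  have := vE (Ordinal q2); rewrite /theta /Defs.theta eqxx big_cons big_seq1.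
  rewrite (lo (q - 1)%N (Ordinal q2)) //; last by lia.
  have -> : ordS (Ordinal q2) = Ordinal q3.
    by apply: val_inj => /=; rewrite modn_small; lia.
  by move=> /(canRL (addrK _)) ->; rewrite /c; ring.
have hi n (b : 'I_(2 * q)) : b = (q + n)%N :> nat -> (n < q)%N ->
    v b = w ^+ n * c * v z.
  elim: n b => [|n IHn] b bn nq.
    by rewrite mul1r -mid; congr v; apply: val_inj; rewrite /= bn addn0.
  have n2 : (q + n < 2 * q)%N by lia.
  rewrite exprS -2!mulrA [w ^+ n * _]mulrA -(IHn (Ordinal n2)) //; last by lia.
  by apply: step => //=; lia.
split.
  have := vE (Ordinal q4); rewrite /theta /Defs.theta ifN ?eqxx /=; last by lia.
  rewrite big_cons big_seq1 (hi (q - 1)%N (Ordinal q4)) /=; try by lia.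
  have -> : ordS (Ordinal q4) = z.
    by apply: val_inj => /=; rewrite z0 subn1 prednK ?modnn; lia.
  move=> E; apply/esym; rewrite -[LHS](addKr (w ^+ (q - 1) * c * v z)) E.
  by rewrite /c; ring.
move=> b; case: ifPn => bq; first exact: lo.
by apply: hi; have := ltn_ord b; lia.
Qed.

End Theta.

(** * Eigenvalues of the incidence matrix and the dominant root *)

Section DominantRoot.
Variables (R : realType) (q : nat) (alpha : R).
Hypotheses (q_ge2 : (2 <= q)%N) (alpha_gt1 : 1 < alpha).
Hypothesis alphaE : alpha ^+ (q - 1) * (alpha - 1) = 1.

(** For w = alpha the factor c of [theta_eigenE] is 1, so the two halves of the eigenvector agree
    and the exponent is b modulo q. *)
Lemma theta_left_eigen (b : 'I_(2 * q)) :
  \sum_(a <- theta b) alpha ^+ (a %% q) = alpha * alpha ^+ (b %% q).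
Proof.
have alphaE' : alpha ^+ (q - 1) + 1 = alpha * alpha ^+ (q - 1).
  by rewrite -[X in _ + X]alphaE; ring.
have lb := ltn_ord b; rewrite /theta; case: eqP => [b1|b1].
  rewrite big_cons big_seq1 /= b1 [(_.+1 %% _)%N]modn_small; last by lia.
  by rewrite subn1 prednK ?modnn ?[(q.-1 %% q)%N]modn_small;
    lia || rewrite -subn1 addrC.
case: eqP => [b2|b2].
  rewrite big_cons big_seq1 /= b2 subn1 prednK ?modnn ?mod0n; last by lia.
  have -> : ((2 * q).-1 = q + (q - 1))%N by lia.
  by rewrite modnDl modn_small //; lia.
rewrite big_seq1 /= -exprS; congr (_ ^+ _).
rewrite modn_dvdm ?dvdn_mull // -addn1 -modnDml addn1 modn_small //.
have [bq|bq] := ltnP b q; first by rewrite modn_small //; lia.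
have -> : (b = q + (b - q) :> nat)%N by lia.
by rewrite modnDl modn_small; lia.
Qed.

(** All entries of an eigenvector are multiples of the entry at the letter 0, which is therefore
    nonzero and can be cancelled. *)
Lemma eigenvalue_incidence_theta (F : fieldType) (w : F) :
  eigenvalue (incidence (@theta q) F) w -> (w ^+ (q - 1) * (w - 1)) ^+ 2 = 1.
Proof.
move=> /eigenvalueP[v vE v_neq0].
have q0 : (0 < 2 * q)%N by lia.
have [|vz vbE] := @theta_eigenE q q_ge2 F w (v 0) (Ordinal q0) erefl.
  by move=> b; rewrite -mul_incidence vE mxE.
have vz0 : v 0 (Ordinal q0) != 0.
  apply: contraNneq v_neq0 => vz0; apply/eqP/rowP => b.
  by rewrite vbE vz0 mxE !mulr0 if_same.
by apply: (mulIf vz0); rewrite mul1r.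
Qed.

Lemma dominant_root_theta : dominant_root (@theta q) alpha.
Proof.
have alpha_gt0 : 0 < alpha by apply: lt_trans alpha_gt1; exact: ltr01.
split=> //.
  apply/eigenvalueP; exists (\row_b alpha ^+ (b %% q)).
    apply/rowP => b; rewrite mul_incidence !mxE -theta_left_eigen.
    by apply: eq_bigr => a _; rewrite mxE.
  have q0 : (0 < 2 * q)%N by lia.
  apply/eqP => /rowP /(_ (Ordinal q0)) /eqP.
  by rewrite !mxE mod0n expr0 oner_eq0.
move=> w /eigenvalue_incidence_theta w1 w_neq.
(* The order of R[i] is partial, but both sides are real, so the contrapositive may assume that |w|
   is at least alpha. *)
rewrite real_ltNge ?normr_real ?complex_real //.
apply: contraNN w_neq => le_alpha.
have a1 : 1 < alpha%:C by rewrite (ltcR 1 alpha).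
have aE : alpha%:C ^+ (q - 1) * (alpha%:C - 1) = 1.
  by rewrite -(rmorph1 (real_complex R)) -rmorphXn -rmorphB -rmorphM alphaE.
have nw : `|w| ^+ (q - 1) * `|w - 1| = 1.
  apply/eqP; rewrite -(@eqrXn2 _ 2) ?ler01 ?mulr_ge0 ?exprn_ge0 //.
  by rewrite -normrX -normrM -normrX w1 normr1 expr1n.
have le1 : `|w| - 1 <= `|w - 1|.
  rewrite lerBlDr -[X in _ + X](normr1 R[i]).
  by rewrite (le_trans _ (ler_normD _ _)) ?subrK.
have w_gt0 : 0 < `|w| ^+ (q - 1).
  by rewrite exprn_gt0 // (lt_le_trans _ le_alpha) // (lt_trans ltr01).
have norm_sub1 : `|w - 1| = alpha%:C - 1.
  apply: le_anti; apply/andP; split; last first.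
    by apply: le_trans le1; rewrite lerD2r.
  (* Upper bound: |w|^(q-1) (alpha - 1) is at least alpha^(q-1) (alpha - 1) = 1 = |w|^(q-1) |w -
     1|. *)
  rewrite -(ler_pM2l w_gt0) nw -[leLHS]aE ler_wpM2r ?subr_ge0 ?(ltW a1) //.
  have a_ge0 := le_trans ler01 (ltW a1).
  by rewrite lerXn2r ?nnegrE.
have norm_w : `|w| = alpha%:C.
  by apply: le_anti; rewrite le_alpha andbT -(lerD2r (-1)) -norm_sub1.
(* Equality in the triangle inequality for (w - 1) + 1: both terms have a common direction t, and
   the term 1 forces t = 1. *)
have [|t t1 [wE]] := @normCDeq _ (w - 1) 1.
  by rewrite subrK normr1 norm_sub1 norm_w subrK.
rewrite normr1 mul1r => t_eq1.
by rewrite -(subrK 1 w) wE -t_eq1 mulr1 norm_sub1 subrK.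
Qed.

End DominantRoot.

(** * The embeddings of Q(alpha) and affine maps of K *)

Section Embedding.
Variables (R : realType) (alpha : R).

(** The rules for [conj_img] below assume arguments in Q(alpha); this and the next closure
    properties discharge that assumption. *)
Lemma in_QadjD z1 z2 :
  in_Qadj alpha z1 -> in_Qadj alpha z2 -> in_Qadj alpha (z1 + z2).
Proof. by move=> [p1 ->] [p2 ->]; exists (p1 + p2); rewrite rmorphD hornerD. Qed.

Lemma in_QadjN z : in_Qadj alpha z -> in_Qadj alpha (- z).
Proof. by move=> [p ->]; exists (- p); rewrite rmorphN hornerN. Qed.

Lemma in_QadjM z1 z2 :
  in_Qadj alpha z1 -> in_Qadj alpha z2 -> in_Qadj alpha (z1 * z2).
Proof. by move=> [p1 ->] [p2 ->]; exists (p1 * p2); rewrite rmorphM hornerM. Qed.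

Lemma in_Qadj_gen : in_Qadj alpha alpha.
Proof. by exists 'X; rewrite map_polyX hornerX. Qed.

Lemma in_Qadj1 : in_Qadj alpha 1.
Proof. by exists 1; rewrite rmorph1 hornerC. Qed.

Lemma in_Qadj0 : in_Qadj alpha 0.
Proof. by exists 0; rewrite rmorph0 horner0. Qed.

Lemma in_QadjX k : in_Qadj alpha (alpha ^+ k).
Proof.
elim: k => [|k IHk]; first exact: in_Qadj1.
by rewrite exprS; apply: in_QadjM => //; exact: in_Qadj_gen.
Qed.

Section Conjugate.
Variables (F : numFieldType) (m : {poly rat}) (b : F).
Hypotheses (m_alpha : is_minpoly m alpha) (m_b : root (map_poly ratr m) b).

Let imgE p := @conj_imgE R F alpha b m p m_alpha m_b.

Lemma conj_imgD z1 z2 : in_Qadj alpha z1 -> in_Qadj alpha z2 ->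
  conj_img alpha b (z1 + z2) = conj_img alpha b z1 + conj_img alpha b z2.
Proof.
by move=> [p1 ->] [p2 ->]; rewrite -hornerD -rmorphD !imgE rmorphD hornerD.
Qed.

Lemma conj_imgN z : in_Qadj alpha z ->
  conj_img alpha b (- z) = - conj_img alpha b z.
Proof. by move=> [p ->]; rewrite -hornerN -rmorphN !imgE rmorphN hornerN. Qed.

Lemma conj_imgM z1 z2 : in_Qadj alpha z1 -> in_Qadj alpha z2 ->
  conj_img alpha b (z1 * z2) = conj_img alpha b z1 * conj_img alpha b z2.
Proof.
by move=> [p1 ->] [p2 ->]; rewrite -hornerM -rmorphM !imgE rmorphM hornerM.
Qed.

Lemma conj_img_gen : conj_img alpha b alpha = b.
Proof.
by have := imgE 'X; rewrite !map_polyX !hornerX.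
Qed.

Lemma conj_img1 : conj_img alpha b 1 = 1.
Proof. by have := imgE 1; rewrite !rmorph1 !hornerC. Qed.

Lemma conj_img0 : conj_img alpha b 0 = 0.
Proof. by have := imgE 0; rewrite !rmorph0 !horner0. Qed.

(** If p vanishes at the conjugate b, then p and the irreducible m have a common root, so m divides
    p and p vanishes at alpha. *)
Lemma conj_img_neq0 z : in_Qadj alpha z -> z != 0 -> conj_img alpha b z != 0.
Proof.
move=> [p ->]; rewrite imgE; apply: contraNneq => /eqP pb.
case: m_alpha => _ irr_m ma.
suff /dvdpP[u ->] : m %| p by rewrite rmorphM -rootE rootM ma orbT.
have ncop : ~~ coprimep m p.
  apply/negP; rewrite -(coprimep_map (ratr : {rmorphism rat -> F})).
  by move=> /coprimep_root /(_ m_b); rewrite pb.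
have /andP[_ m_gcd] := irr_m.2 _ ncop (dvdp_gcdl m p).
exact: dvdp_trans m_gcd (dvdp_gcdr _ _).
Qed.

End Conjugate.

(** The polynomial that [conj_img] picks for z does not depend on w, and its rational coefficients
    are fixed by conjugation. *)
Lemma conj_img_conjc (w : R[i]) z :
  conj_img alpha (conjc w) z = conjc (conj_img alpha w z).
Proof.
rewrite /conj_img; set p := xget _ _; rewrite -horner_map -map_poly_comp.
by congr (_.[_]); apply: eq_map_poly => x /=; rewrite fmorph_rat.
Qed.

Lemma root_real_complex (p : {poly rat}) (x : R) :
  root (map_poly ratr p) x%:C = root (map_poly ratr p) x.
Proof.
have -> : map_poly ratr p = map_poly (real_complex R) (map_poly ratr p).
  by rewrite -map_poly_comp; apply: eq_map_poly => c /=; rewrite fmorph_rat.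
by rewrite fmorph_root.
Qed.

End Embedding.

Section Affine.
Variables (R : realType) (alpha : R) (r s : nat).
Variables (rs : r.-tuple R) (cs : s.-tuple R[i]).

(** The maps f_L, f_R and g_U and the parametrizations of the X_k all have this form. With
    coefficients in Q(alpha) they compose like the maps x -> u + v x of Q(alpha), so identities
    between maps become identities between numbers. *)
Definition affine (u v : R) (x : K R r s) : K R r s :=
  psi alpha rs cs u + Psi alpha rs cs v x.

Lemma affine1 u v x i :
  (affine u v x).1 0 i =
  conj_img alpha (tnth rs i) u + conj_img alpha (tnth rs i) v * x.1 0 i.
Proof. by rewrite !mxE. Qed.

Lemma affine2 u v x j :
  (affine u v x).2 0 j =
  conj_img alpha (tnth cs j) u + conj_img alpha (tnth cs j) v * x.2 0 j.
Proof. by rewrite !mxE. Qed.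

End Affine.

Section ConjugateSpace.
Variables (R : realType) (alpha : R) (r s : nat).
Variables (rs : r.-tuple R) (cs : s.-tuple R[i]).
Hypothesis enum : conj_enum alpha rs cs.

Let ws := [seq x%:C | x <- rs] ++ cs ++ [seq conjc w | w <- cs].

Lemma tnth_rs_conj i :
  exists2 m, is_minpoly m alpha & root (map_poly ratr m) (tnth rs i).
Proof.
have [_ _ /(_ (tnth rs i)%:C)[H _]] := enum.
have /H[[m m1 m2] _] : (tnth rs i)%:C \in ws.
  by rewrite mem_cat map_f ?mem_tnth.
by exists m => //; rewrite -root_real_complex.
Qed.

Lemma tnth_cs_conj j :
  exists2 m, is_minpoly m alpha & root (map_poly ratr m) (tnth cs j).
Proof.
have [_ _ /(_ (tnth cs j))[H _]] := enum.
have /H[[m m1 m2] _] : tnth cs j \in ws.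
  by rewrite !mem_cat mem_tnth orbT.
by exists m.
Qed.

Lemma tnth_rs_lt1 i : pisot alpha -> `|tnth rs i| < 1.
Proof.
move=> [_ _ H]; have [_ _ /(_ (tnth rs i)%:C)[E _]] := enum.
have /E[E1 E2] : (tnth rs i)%:C \in ws by rewrite mem_cat map_f ?mem_tnth.
by have := H _ E1 E2; rewrite normc_def /= expr0n addr0 sqrtr_sqr (ltcR _ 1).
Qed.

Lemma tnth_cs_lt1 j : pisot alpha -> `|tnth cs j| < 1.
Proof.
move=> [_ _ H]; have [_ _ /(_ (tnth cs j))[E _]] := enum.
have /E[E1 E2] : tnth cs j \in ws by rewrite !mem_cat mem_tnth orbT.
exact: H.
Qed.

Local Notation psi := (psi alpha rs cs).
Local Notation affine := (affine alpha rs cs).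

Lemma K_eqP (x y : K R r s) :
  (forall i, x.1 0 i = y.1 0 i) -> (forall j, x.2 0 j = y.2 0 j) -> x = y.
Proof.
by case: x y => [x1 x2] [y1 y2] /= E1 E2; congr pair; apply/rowP.
Qed.

Lemma affine01 x : affine 0 1 x = x.
Proof.
apply: K_eqP => k; [rewrite affine1 | rewrite affine2].
  have [m m1 m2] := tnth_rs_conj k.
  by rewrite (conj_img0 m1 m2) (conj_img1 m1 m2) add0r mul1r.
have [m m1 m2] := tnth_cs_conj k.
by rewrite (conj_img0 m1 m2) (conj_img1 m1 m2) add0r mul1r.
Qed.

Lemma affine_comp u v u' v' x :
  in_Qadj alpha u -> in_Qadj alpha v -> in_Qadj alpha u' -> in_Qadj alpha v' ->
  affine u v (affine u' v' x) = affine (u + v * u') (v * v') x.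
Proof.
move=> Qu Qv Qu' Qv'; have Qvu := in_QadjM Qv Qu'.
apply: K_eqP => [i|j].
  have [m m1 m2] := tnth_rs_conj i.
  rewrite [LHS]affine1 [RHS]affine1 [in LHS]affine1 (conj_imgD m1 m2 Qu Qvu).
  by rewrite (conj_imgM m1 m2 Qv Qu') (conj_imgM m1 m2 Qv Qv') mulrDr addrA mulrA.
have [m m1 m2] := tnth_cs_conj j.
rewrite [LHS]affine2 [RHS]affine2 [in LHS]affine2 (conj_imgD m1 m2 Qu Qvu).
by rewrite (conj_imgM m1 m2 Qv Qu') (conj_imgM m1 m2 Qv Qv') mulrDr addrA mulrA.
Qed.

Lemma fL_affine x : fL alpha rs cs x = affine 0 alpha x.
Proof.
apply: K_eqP => [i|j]; [rewrite affine1 !mxE | rewrite affine2 !mxE].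
  by have [m m1 m2] := tnth_rs_conj i; rewrite (conj_img0 m1 m2) add0r.
by have [m m1 m2] := tnth_cs_conj j; rewrite (conj_img0 m1 m2) add0r.
Qed.

Lemma fR_affine x (beta := alpha / (alpha - 1)) : in_Qadj alpha beta ->
  fR alpha rs cs x = affine beta (- beta) x.
Proof.
move=> Qb; apply: K_eqP => [i|j]; [rewrite affine1 !mxE | rewrite affine2 !mxE].
  have [m m1 m2] := tnth_rs_conj i.
  by rewrite (conj_img1 m1 m2) (conj_imgN m1 m2) // mulrBr mulr1 mulNr.
have [m m1 m2] := tnth_cs_conj j.
by rewrite (conj_img1 m1 m2) (conj_imgN m1 m2) // mulrBr mulr1 mulNr.
Qed.

Lemma iter_fL_affine k x : iter k (fL alpha rs cs) x = affine 0 (alpha ^+ k) x.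
Proof.
elim: k => [|k IHk] /=; first by rewrite affine01.
rewrite IHk fL_affine.
have Q0 := in_Qadj0 alpha.
rewrite (affine_comp _ Q0 (in_Qadj_gen alpha) Q0 (in_QadjX alpha k)).
by congr affine; [rewrite mulr0 addr0 | rewrite exprS].
Qed.

Lemma psi_sub_affine w u v x :
  in_Qadj alpha w -> in_Qadj alpha u -> in_Qadj alpha v ->
  psi w - affine u v x = affine (w - u) (- v) x.
Proof.
move=> Qw Qu Qv; have Qnu := in_QadjN Qu.
apply: K_eqP => [i|j]; [rewrite affine1 !mxE | rewrite affine2 !mxE].
  have [m m1 m2] := tnth_rs_conj i.
  by rewrite (conj_imgD m1 m2) // !(conj_imgN m1 m2) // opprD addrA mulNr.
have [m m1 m2] := tnth_cs_conj j.
by rewrite (conj_imgD m1 m2) // !(conj_imgN m1 m2) // opprD addrA mulNr.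
Qed.

Lemma gmap_affine (n : nat) (nu : 'rV[R]_n) (U : seq 'I_n) x :
  gmap alpha nu rs cs U x = affine (\sum_(c <- U) nu 0 c) alpha x.
Proof.
rewrite /gmap sum_count_mem.
apply: K_eqP => [i|j]; [rewrite affine1 !mxE | rewrite affine2 !mxE].
  by have [m m1 m2] := tnth_rs_conj i; rewrite (conj_img_gen m1 m2).
by have [m m1 m2] := tnth_cs_conj j; rewrite (conj_img_gen m1 m2).
Qed.

End ConjugateSpace.

(** * Topology of K and uniqueness of the Rauzy family *)

Section Continuity.
Variable T : topologicalType.

Lemma continuous_rV (U : topologicalType) n (f : T -> 'rV[U]_n) :
  (forall i, continuous (fun x => f x 0 i)) -> continuous f.
Proof.
move=> fc x A [P Pf PA].
have : \forall y \near x, forall i, P 0 i (f y 0 i).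
  by apply: filter_forall => i; apply: fc; exact: Pf.
apply: filterS => y Py; apply: PA => i j; rewrite ord1; exact: Py.
Qed.

Lemma continuous_pair (U V : topologicalType) (f : T -> U * V) :
  continuous (fun x => (f x).1) -> continuous (fun x => (f x).2) ->
  continuous f.
Proof.
move=> f1 f2; rewrite (_ : f = fun x => ((f x).1, (f x).2)); last first.
  by apply/funext => x; case: (f x).
by move=> x; apply: cvg_pair; [exact: f1 | exact: f2].
Qed.

Lemma continuous_sum (F : numFieldType) (V : normedModType F) (I : finType)
    (P : pred I) (f : I -> T -> V) :
  (forall i, P i -> continuous (f i)) ->
  continuous (fun x => \sum_(i | P i) f i x).
Proof.
move=> fc x; apply: cvg_big => [|i Pi]; last exact: fc.
exact: add_continuous.
Qed.

End Continuity.

Section ConjugateSpaceTopology.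
Variable R : realType.

Lemma coord_continuous1 r s (i : 'I_r) : continuous (fun x : K R r s => x.1 0 i).
Proof.
move=> x; apply: (@cvg_comp _ _ _ fst (fun M : 'rV[R]_r => M 0 i)).
  exact: cvg_fst.
exact: coord_continuous.
Qed.

Lemma coord_continuous2 r s (j : 'I_s) :
  continuous (fun x : K R r s => x.2 0 j : R[i]^o).
Proof.
move=> x; apply: (@cvg_comp _ _ _ snd (fun M : 'rV[R[i]^o]_s => M 0 j)).
  exact: cvg_snd.
exact: coord_continuous.
Qed.

Lemma continuous_K (T : topologicalType) r s (f : T -> K R r s) :
  (forall i, continuous (fun x => (f x).1 0 i)) ->
  (forall j, continuous (fun x => (f x).2 0 j : R[i]^o)) -> continuous f.
Proof. by move=> f1 f2; apply: continuous_pair; exact: continuous_rV. Qed.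

Lemma compact_image (T U : topologicalType) (f : T -> U) (A : set T) :
  continuous f -> compact A -> compact (f @` A).
Proof. by move=> fc; apply/continuous_compact/continuous_subspaceT. Qed.

(** The factors are normed over the different fields R and R[i], so points are separated in each
    factor, through the projections. *)
Lemma K_hausdorff r s : hausdorff_space (K R r s).
Proof.
move=> [p1 p2] [q1 q2] pq; congr pair.
  apply: (@norm_hausdorff _ 'rV[R]_r) => A B pA qB.
  have [[x1 x2] [/= xA xB]] := pq (fst @^-1` A) (fst @^-1` B)
    (cvg_fst pA) (cvg_fst qB).
  by exists x1.
apply: (@norm_hausdorff _ 'rV[R[i]^o]_s) => A B pA qB.
have [[x1 x2] [/= xA xB]] := pq (snd @^-1` A) (snd @^-1` B)
  (cvg_snd pA) (cvg_snd qB).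
by exists x2.
Qed.

(** A single real-valued norm for both factors; [Normc.normc] is the complex modulus with values in
    R rather than in R[i]. *)
Definition normK r s (x : K R r s) : R :=
  \sum_i `|x.1 0 i| + \sum_j Normc.normc (x.2 0 j).

Let normc_ge0 (z : R[i]) : 0 <= Normc.normc z.
Proof. by case: z => a b; rewrite sqrtr_ge0. Qed.

Lemma le_normK1 r s (x : K R r s) i : `|x.1 0 i| <= normK x.
Proof.
by rewrite /normK (bigD1 i) //= -addrA ler_wpDr // addr_ge0 // ?sumr_ge0.
Qed.

Lemma le_normK2 r s (x : K R r s) j : Normc.normc (x.2 0 j) <= normK x.
Proof.
rewrite /normK [X in _ + X](bigD1 j) //= addrCA ler_wpDr // addr_ge0 //.
  exact: sumr_ge0.
exact: sumr_ge0.
Qed.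

Lemma ler_normKB r s (x y : K R r s) : normK (x - y) <= normK x + normK y.
Proof.
rewrite /normK addrACA -!big_split /= lerD // ler_sum // => i _.
  by rewrite !mxE ler_normB.
by rewrite !mxE -(normcN (y.2 0 i)) le_normcD.
Qed.

(** The reverse triangle inequality, read in R[i] after embedding the real moduli there. *)
Lemma normc_continuous : continuous (@Normc.normc R : R[i]^o -> R).
Proof.
move=> w.
apply: (proj2 (@cvgrPdist_lt R R _ _ (nbhs_filter (w : R[i]^o)) _ _)) => e e0.
have : nbhs (w : R[i]^o) (ball (w : R[i]^o) e%:C).
  by apply: nbhsx_ballx; rewrite (ltcR 0).
rewrite -ball_normE; apply: filterS => z; rewrite -ltcR; apply: le_lt_trans.
have -> : `|Normc.normc w - Normc.normc z|%:C = `| `|w| - `|z| | :> R[i].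
  by rewrite /= -rmorphB normc_def /= expr0n addr0 sqrtr_sqr.
exact: ler_dist_dist.
Qed.

Lemma normK_continuous r s : continuous (@normK r s).
Proof.
move=> x; apply: cvgD.
  apply: continuous_sum => i _ {}x.
  by apply: cvg_norm; exact: coord_continuous1.
apply: continuous_sum => j _ {}x.
apply: (@cvg_comp _ _ _ (fun x : K R r s => x.2 0 j : R[i]^o)).
  exact: coord_continuous2.
exact: normc_continuous.
Qed.

Lemma compact_normK_bounded r s (A : set (K R r s)) :
  compact A -> exists M, forall x, A x -> normK x <= M.
Proof.
move=> /(compact_image (@normK_continuous r s)) /compact_bounded.
move=> [M [_ MP]]; exists (M + 1) => x Ax; apply: le_trans (ler_norm _) _.
by apply: (MP (M + 1)); [rewrite ltrDl | exists x].
Qed.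

(** A compact subset of a Hausdorff space is closed, and x lies in the closure of A because [normK]
    dominates every coordinate. *)
Lemma compact_normK_approx r s (A : set (K R r s)) x : compact A ->
  (forall e, 0 < e -> exists2 y, A y & normK (x - y) < e) -> A x.
Proof.
move=> /(compact_closed (@K_hausdorff r s)) clA xA; apply: clA => B.
case=> -[B1 B2] /= [nB1 nB2] sB.
have /nbhs_ballP[e1 e1_gt0 eB1] := nB1; have /nbhs_ballP[e2 e2_gt0 eB2] := nB2.
(* The radius for the complex factor is an element of R[i]; being positive it is real, and its real
   part can be compared with [e1]. *)
have Re_gt0 : 0 < complex.Re e2.
  have : 0 < e2 := e2_gt0.
  by rewrite ltcE => /andP[_].
have e2E : (complex.Re e2)%:C = e2 by rewrite RRe_real // gtr0_real.
have [|y Ay xy] := xA (Num.min e1 (complex.Re e2)).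
  by rewrite lt_min Re_gt0 andbT.
move: xy; rewrite lt_min => /andP[xy1 xy2].
exists y; split=> //; apply: sB; split => /=.
  apply: eB1; split=> // i j; rewrite ord1 -ball_normE /=.
  have := le_lt_trans (le_normK1 _ j) xy1; by rewrite !mxE.
apply: eB2; split=> // i j; rewrite ord1 -ball_normE /=.
have := le_lt_trans (le_normK2 _ j) xy2; by rewrite !mxE -ltcR e2E.
Qed.

End ConjugateSpaceTopology.

Section RauzyUnique.
Variables (R : realType) (m : nat) (zeta : 'I_m -> seq 'I_m).
Variables (lam : R) (nu : 'rV[R]_m) (r s : nat).
Variables (rs : r.-tuple R) (cs : s.-tuple R[i]).
Hypothesis rs_lt1 : forall i, `|tnth rs i| < 1.
Hypothesis cs_lt1 : forall j, `|tnth cs j| < 1.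

Lemma normK_conj_mul :
  exists2 rho, 0 <= rho < 1 &
    forall x : K R r s, normK (conj_mul rs cs x) <= rho * normK x.
Proof.
(* The base value 0 keeps rho nonnegative and below 1 even when there are no conjugates of one
   kind. *)
pose rho := Num.max (\big[Num.max/0]_i `|tnth rs i|)
                    (\big[Num.max/0]_j Normc.normc (tnth cs j)).
exists rho.
  rewrite le_max bigmax_ge_id /= gt_max; apply/andP; split.
    by apply/bigmax_ltP; split => // i _.
  by apply/bigmax_ltP; split => // j _; have := cs_lt1 j; rewrite (ltcR _ 1).
move=> x; rewrite /normK mulrDr !mulr_sumr lerD // ler_sum // => i _.
  rewrite !mxE normrM ler_wpM2r // le_max; apply/orP; left.
  exact: (le_bigmax_cond _ (fun i => `|tnth rs i|)).
rewrite !mxE Normc.normcM ler_wpM2r //.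
  by case: (x.2 0 i) => a b; rewrite sqrtr_ge0.
rewrite le_max; apply/orP; right.
exact: (le_bigmax_cond _ (fun j => Normc.normc (tnth cs j))).
Qed.

(** Following the equations of X backwards n times and those of Y forwards through the same maps
    puts a point of Y a within rho^n M of any given point of X a; Y a is compact and so contains the
    limit. *)
Lemma rauzy_family_sub (X Y : 'I_m -> set (K R r s)) :
  rauzy_family zeta lam nu rs cs X -> rauzy_family zeta lam nu rs cs Y ->
  forall a, X a `<=` Y a.
Proof.
move=> famX famY.
have [rho /andP[rho_ge0 rho_lt1] rhoP] := normK_conj_mul.
have [M MP] : exists M, forall a x y, X a x -> Y a y -> normK (x - y) <= M.
  have /choice[MX MXP] a : exists M, forall x, X a x -> normK x <= M.
    by have [_ /compact_normK_bounded] := famX a.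
  have /choice[MY MYP] a : exists M, forall x, Y a x -> normK x <= M.
    by have [_ /compact_normK_bounded] := famY a.
  exists (\sum_a (`|MX a| + `|MY a|)) => a x y Xx Yy.
  apply: (le_trans (ler_normKB _ _)); rewrite (bigD1 a) //= ler_wpDr //.
    by apply: sumr_ge0 => b _; rewrite addr_ge0.
  rewrite lerD // (le_trans _ (ler_norm _)) //; [exact: MXP | exact: MYP].
have approx n a x : X a x -> exists2 y, Y a y & normK (x - y) <= rho ^+ n * M.
  elim: n a x => [|n IHn] a x Xx.
    have [[y Yy] _ _] := famY a; exists y => //.
    by rewrite expr0 mul1r; exact: (MP a).
  have [_ _ XE] := famX a; have [_ _ YE] := famY a.
  move: Xx; rewrite XE => -[[[b U] V] /= zb [x' Xx' <-]].
  have [y' Yy' xy'] := IHn _ _ Xx'; exists (gmap lam nu rs cs U y').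
    by rewrite YE; exists (b, U, V) => //; exists y'.
  (* The two images share their translation, so their difference is [conj_mul] of x' - y'. *)
  rewrite exprS -mulrA; apply: le_trans (ler_wpM2l rho_ge0 xy').
  apply: le_trans (rhoP _); rewrite le_eqVlt; apply/orP; left; apply/eqP.
  congr normK; rewrite /gmap opprD addrACA subrr add0r.
  by apply: K_eqP => i; rewrite !mxE mulrBr.
move=> a x Xx; apply: compact_normK_approx; first by have [] := famY a.
move=> e e_gt0.
have [n nP] : exists n, rho ^+ n * M < e.
  have : (rho ^+ n * M) @[n --> \oo] --> (0 : R).
    rewrite -(mul0r M); apply: cvgMr_tmp; apply: cvg_expr.
    by rewrite ger0_norm.
  move=> /cvgr_lt /(_ e e_gt0) [n _ nP]; exists n; exact: (nP n (leqnn n)).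
have [y Yy xy] := approx n a x Xx; exists y => //; exact: le_lt_trans nP.
Qed.

Lemma rauzy_family_unique (X Y : 'I_m -> set (K R r s)) :
  rauzy_family zeta lam nu rs cs X -> rauzy_family zeta lam nu rs cs Y -> X = Y.
Proof.
by move=> fX fY; apply/funext => a; apply/seteqP; split; exact: rauzy_family_sub.
Qed.

End RauzyUnique.

(** * Change of enumeration of the conjugates *)

Section Coordinates.
Variables (R : realType) (alpha : R) (r s : nat).
Variables (rs : r.-tuple R) (cs : s.-tuple R[i]).
Hypothesis enum : conj_enum alpha rs cs.

(** The coordinate indexed by the conjugate u itself instead of its position. As a sum it is visibly
    linear in x, and it has one term when u is listed once. *)
Definition real_coord (x : K R r s) (u : R) : R :=
  \sum_(i | tnth rs i == u) x.1 0 i.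

(** The list may contain w or its complex conjugate; in the second case the coordinate at w is the
    conjugate of the listed one. *)
Definition complex_coord (x : K R r s) (w : R[i]) : R[i] :=
  \sum_(j | tnth cs j == w) x.2 0 j +
  \sum_(j | conjc (tnth cs j) == w) conjc (x.2 0 j).

Lemma real_coord_tnth x i : real_coord x (tnth rs i) = x.1 0 i.
Proof.
have [uniq_ws _ _] := enum.
have /tuple_uniqP rs_inj : uniq rs.
  by move: uniq_ws; rewrite cat_uniq => /and3P[/map_uniq].
by rewrite /real_coord (big_pred1 i) // => j; rewrite (inj_eq rs_inj).
Qed.

Lemma complex_coord_conjc x w :
  complex_coord x (conjc w) = conjc (complex_coord x w).
Proof.
rewrite /complex_coord rmorphD !rmorph_sum addrC; congr (_ + _).
  by apply: eq_bigl => j; rewrite (inj_eq (can_inj (@conjcK R))).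
apply: eq_big => [j|j _]; last by rewrite /= conjcK.
by rewrite -(inj_eq (can_inj (@conjcK R))) conjcK.
Qed.

Lemma complex_coord_tnth x j : complex_coord x (tnth cs j) = x.2 0 j.
Proof.
have [uniq_ws _ _] := enum.
move: uniq_ws; rewrite cat_uniq cat_uniq.
move=> /and3P[_ _ /and3P[/tuple_uniqP cs_inj /hasPn disj _]].
rewrite /complex_coord (big_pred1 j) => [|k]; last by rewrite (inj_eq cs_inj).
(* The second sum is empty: no member of [cs] is the conjugate of a member. *)
rewrite big_pred0 ?addr0 // => k; apply/negP => /eqP kj.
have /disj /negP[] : conjc (tnth cs k) \in [seq conjc w | w <- cs].
  by rewrite map_f ?mem_tnth.
by rewrite kj mem_tnth.
Qed.

Lemma real_coord_affine u v x w : w \in (rs : seq R) ->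
  real_coord (affine alpha rs cs u v x) w =
  conj_img alpha w u + conj_img alpha w v * real_coord x w.
Proof. by move=> /tnthP[i ->]; rewrite !real_coord_tnth affine1. Qed.

Lemma complex_coord_affine u v x w :
  w \in (cs : seq R[i]) \/ conjc w \in (cs : seq R[i]) ->
  complex_coord (affine alpha rs cs u v x) w =
  conj_img alpha w u + conj_img alpha w v * complex_coord x w.
Proof.
case=> /tnthP[j wj]; first by rewrite wj !complex_coord_tnth affine2.
rewrite -[w]conjcK wj !complex_coord_conjc !complex_coord_tnth affine2.
by rewrite rmorphD rmorphM !conj_img_conjc.
Qed.

(** The right-hand side depends on alpha alone, so any two enumerations list the same real
    conjugates; [mem_cs_conj] does the same for the non-real ones up to conjugation. *)
Lemma mem_rs_conj u :
  u \in (rs : seq R) <-> galois_conjugate alpha u%:C /\ u%:C != alpha%:C.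
Proof.
have [_ /allP Im_cs <-] := enum; rewrite !mem_cat; split=> [urs|].
  by rewrite map_f.
case/or3P => [/mapP[v vrs /complexI ->] //|/Im_cs|/mapP[w /Im_cs]].
  by rewrite eqxx.
by case: w => a b /= b0 [_ /esym/eqP]; rewrite oppr_eq0 (negPf b0).
Qed.

Lemma mem_cs_conj w :
  (w \in (cs : seq R[i]) \/ conjc w \in (cs : seq R[i])) <->
  [/\ galois_conjugate alpha w, w != alpha%:C & complex.Im w != 0].
Proof.
have [_ /allP Im_cs wsP] := enum.
have csP : (w \in (cs : seq R[i])) || (conjc w \in (cs : seq R[i])) =
           (w \in (cs : seq R[i])) || (w \in [seq conjc w | w <- cs]).
  by rewrite -[X in _ || (X \in map _ _)]conjcK (mem_map (can_inj (@conjcK R))).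
split=> [/orP wcs|[w_conj w_neq Im_w]].
  have Im_w : complex.Im w != 0.
    by case/orP: wcs => /Im_cs //; case: (w) => a b /=; rewrite oppr_eq0.
  have [] // := (wsP w).1.
  by rewrite !mem_cat -csP wcs orbT.
apply/orP; rewrite csP; have := (wsP w).2 (conj w_conj w_neq).
rewrite !mem_cat => /or3P[/mapP[u _ wu]|->|->]; rewrite ?orbT //.
by move: Im_w; rewrite wu eqxx.
Qed.

End Coordinates.

Section Transport.
Variables (R : realType) (alpha : R) (r s r' s' : nat).
Variables (rs : r.-tuple R) (cs : s.-tuple R[i]).
Variables (rs' : r'.-tuple R) (cs' : s'.-tuple R[i]).

(* Two enumerations of the conjugates differ by a permutation and by the choice
   of the representatives of the pairs of non-real conjugates. *)
Definition transport (x : K R r s) : K R r' s' :=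
  (\row_i real_coord rs x (tnth rs' i), \row_j complex_coord cs x (tnth cs' j)).

Lemma transport_linear : linearK transport.
Proof.
move=> c x y; apply: K_eqP => k; rewrite !mxE.
  rewrite /real_coord mulr_sumr -big_split /=.
  by apply: eq_bigr => i _; rewrite !mxE.
rewrite /complex_coord mulrDr addrACA !mulr_sumr -!big_split /=.
congr (_ + _); apply: eq_bigr => j _; rewrite !mxE //.
(* Conjugation fixes the scalar c because it is real. *)
by rewrite rmorphD rmorphM /= oppr0.
Qed.

Lemma conjc_continuous : continuous (@conjc R : R[i]^o -> R[i]^o).
Proof.
move=> w A /nbhs_ballP[e e_gt0 eA]; apply/nbhs_ballP; exists e => // z wz.
apply: eA; move: wz; rewrite -!ball_normE /= -rmorphB.
suff -> : `|conjc (w - z)| = `|w - z| by [].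
by case: (w - z) => a b; rewrite !normc_def /= sqrrN.
Qed.

Lemma transport_continuous : continuous transport.
Proof.
apply: continuous_K => k.
  have -> : (fun x => (transport x).1 0 k) =
            fun x => real_coord rs x (tnth rs' k).
    by apply/funext => x; rewrite mxE.
  by apply: continuous_sum => i _; exact: coord_continuous1.
have -> : (fun x => (transport x).2 0 k : R[i]^o) =
          fun x => (complex_coord cs x (tnth cs' k) : R[i]^o).
  by apply/funext => x; rewrite mxE.
move=> x; apply: cvgD.
  by apply: continuous_sum => i _; exact: coord_continuous2.
apply: continuous_sum => j _ {}x.
apply: (@cvg_comp _ _ _ (fun x : K R r s => x.2 0 j : R[i]^o)).
  exact: coord_continuous2.
exact: conjc_continuous.
Qed.

Hypotheses (enum : conj_enum alpha rs cs) (enum' : conj_enum alpha rs' cs').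

Lemma transport_affine u v x :
  transport (affine alpha rs cs u v x) = affine alpha rs' cs' u v (transport x).
Proof.
apply: K_eqP => k; [rewrite affine1 !mxE | rewrite affine2 !mxE].
  apply: (real_coord_affine enum).
  apply/(mem_rs_conj enum)/(mem_rs_conj enum'); exact: mem_tnth.
apply: (complex_coord_affine enum).
apply/(mem_cs_conj enum)/(mem_cs_conj enum'); left; exact: mem_tnth.
Qed.

End Transport.

Lemma transportK (R : realType) (alpha : R) (r s r' s' : nat)
    (rs : r.-tuple R) (cs : s.-tuple R[i])
    (rs' : r'.-tuple R) (cs' : s'.-tuple R[i]) :
  conj_enum alpha rs cs -> conj_enum alpha rs' cs' ->
  cancel (transport rs cs rs' cs') (transport rs' cs' rs cs).
Proof.
move=> enum enum' x; apply: K_eqP => k; rewrite !mxE.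
  have /(mem_rs_conj enum)/(mem_rs_conj enum')/tnthP[i ki] :
    tnth rs k \in (rs : seq R) by exact: mem_tnth.
  by rewrite ki (real_coord_tnth enum') mxE -ki (real_coord_tnth enum).
have /(mem_cs_conj enum)/(mem_cs_conj enum')[] :
  tnth cs k \in (cs : seq R[i]) \/ conjc (tnth cs k) \in (cs : seq R[i]).
- by left; exact: mem_tnth.
- move=> /tnthP[i ki].
  by rewrite ki (complex_coord_tnth enum') mxE -ki (complex_coord_tnth enum).
(* Here the second enumeration chose the other member of the pair, and the two conjugations
   cancel. *)
move=> /tnthP[i ki]; rewrite -[tnth cs k]conjcK ki complex_coord_conjc.
rewrite (complex_coord_tnth enum') mxE -ki -complex_coord_conjc conjcK.
by rewrite (complex_coord_tnth enum).
Qed.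

(** * The Rauzy equations *)

Section ThetaOccurrences.
Variable q : nat.
Hypothesis q_ge2 : (2 <= q)%N.

(** The occurrences of a letter in [theta b] with their prefixes; the suffix is left out since
    [gmap] does not see it. A shift has a nonempty prefix only at 2q - 1, a loop only at q - 1. *)
Variant theta_occ (b : 'I_(2 * q)) : 'I_(2 * q) -> seq 'I_(2 * q) -> Prop :=
| ThetaShift :
    theta_occ b (ordS b) (if (b == 2 * q - 1 :> nat)%N then [:: b] else [::])
| ThetaLoop1 of b = (q - 1)%N :> nat : theta_occ b b [:: ordS b]
| ThetaLoop2 of b = (2 * q - 1)%N :> nat : theta_occ b b [::].

Lemma theta_occP (b a : 'I_(2 * q)) U :
  (exists V, theta b = U ++ a :: V) <-> theta_occ b a U.
Proof.
have bb : (q - 1 == 2 * q - 1)%N = false by lia.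
have bb' : (2 * q - 1 == q - 1)%N = false by lia.
split.
  rewrite /theta; case: ifP => [/eqP b1|b1].
    case=> V; case: U => [[<- _]|u [[<- <- _]|u' [|]//]].
    - by have := ThetaShift b; rewrite b1 bb.
    - exact: ThetaLoop1.
  case: ifP => [/eqP b2|b2].
    case=> V; case: U => [[<- _]|u [[<- <- _]|u' [|]//]].
    - exact: ThetaLoop2.
    - by have := ThetaShift b; rewrite b2 eqxx.
  case=> V; case: U => [[<- _]|u [|]//].
  by have := ThetaShift b; rewrite b2.
case=> [|b1|b2]; rewrite /theta.
- case: ifP => [/eqP b1|b1]; first by rewrite b1 bb; exists [:: b].
  by case: ifP => b2; exists [::].
- by rewrite b1 eqxx; exists [::].
- by rewrite b2 bb' eqxx; exists [:: ordS b].
Qed.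

End ThetaOccurrences.

Section TentCoefficients.
Variables (R : realType) (alpha : R) (q : nat).
Hypotheses (q_ge2 : (2 <= q)%N) (alphaE : alpha ^+ (q - 1) * (alpha - 1) = 1).

(* X_k = psi (tent_shift k) + Psi (tent_scale k) F, with beta = alpha^q. *)
Definition tent_shift (k : nat) : R :=
  if (k < q - 1)%N then alpha ^+ k * (1 - alpha ^+ q)
  else if (k == q - 1)%N then alpha ^+ (q - 1)
  else if (k < 2 * q - 1)%N then alpha ^+ (k - q) * alpha ^+ q
  else 0.

Definition tent_scale (k : nat) : R :=
  if (k < q - 1)%N then alpha ^+ k * alpha ^+ q
  else if (k == q - 1)%N then - alpha ^+ (q - 1)
  else if (k < 2 * q - 1)%N then - (alpha ^+ (k - q) * alpha ^+ q)
  else alpha ^+ (q - 1).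

Lemma alphaXq : alpha ^+ q = alpha * alpha ^+ (q - 1).
Proof. by rewrite -exprS; congr (_ ^+ _); lia. Qed.

Lemma alphaXq1 : alpha ^+ q = alpha ^+ (q - 1) + 1.
Proof. by rewrite alphaXq -[X in _ + X]alphaE; ring. Qed.

Lemma in_Qadj_tent_shift k : in_Qadj alpha (tent_shift k).
Proof.
rewrite /tent_shift; do 3?case: ifP => _; do ?[exact: in_QadjX | exact: in_Qadj0].
  apply: in_QadjM; first exact: in_QadjX.
  by apply: in_QadjD; [exact: in_Qadj1 | apply: in_QadjN; exact: in_QadjX].
by apply: in_QadjM; exact: in_QadjX.
Qed.

Lemma in_Qadj_tent_scale k : in_Qadj alpha (tent_scale k).
Proof.
rewrite /tent_scale; do 3?case: ifP => _; do ?[apply: in_QadjN];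
  do ?[exact: in_QadjX]; by apply: in_QadjM; exact: in_QadjX.
Qed.

(** At q - 1 and 2q - 1 the predecessor supplies only the f_R branch: the right-hand sides are the
    coefficients of X_a composed with x -> alpha^q - alpha^q x. *)
Lemma tent_step_special (b a : nat) :
  (b.+1 = a)%N -> a = (q - 1)%N \/ a = (2 * q - 1)%N ->
  alpha * tent_shift b = tent_shift a + tent_scale a * alpha ^+ q /\
  alpha * tent_scale b = - (tent_scale a * alpha ^+ q).
Proof.
move=> ba [] aE; rewrite /tent_shift /tent_scale aE.
  rewrite (_ : (b < q - 1)%N); last by lia.
  rewrite ltnn eqxx (_ : (q - 1 = b.+1)%N); last by lia.
  by rewrite [_ ^+ _.+1]exprS; split; ring.
rewrite (_ : (2 * q - 1 < q - 1)%N = false); last by lia.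
rewrite (_ : (2 * q - 1 == q - 1)%N = false); last by lia.
rewrite (_ : (b < q - 1)%N = false); last by lia.
rewrite (_ : (b == q - 1)%N = false); last by lia.
rewrite (_ : (b < 2 * q - 1)%N); last by lia.
rewrite ltnn (_ : (q - 1 = (b - q).+1)%N); last by lia.
by rewrite [_ ^+ _.+1]exprS; split; ring.
Qed.

Lemma tent_step (b : nat) : (b.+1 <> q - 1)%N -> (b.+1 < 2 * q - 1)%N ->
  tent_shift b.+1 = alpha * tent_shift b /\
  tent_scale b.+1 = alpha * tent_scale b.
Proof.
move=> b1 b2; rewrite /tent_shift /tent_scale b2.
rewrite (_ : (b.+1 == q - 1)%N = false); last by lia.
have [bq|bq] := ltnP b.+1 (q - 1).
  rewrite (_ : (b < q - 1)%N); last by lia.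
  by rewrite exprS !mulrA.
rewrite (_ : (b < q - 1)%N = false); last by lia.
(* Passage to the second half: at b + 1 = q the exponent restarts at 0, and the remaining factor is
   alpha^q. *)
have [->|bq'] := eqVneq b (q - 1)%N.
  rewrite (_ : ((q - 1).+1 - q = 0)%N); last by lia.
  by rewrite expr0 mul1r mulrN -alphaXq.
rewrite (_ : (b < 2 * q - 1)%N); last by lia.
rewrite (_ : (b.+1 - q = (b - q).+1)%N); last by lia.
by rewrite exprS mulrN !mulrA.
Qed.

(** The passage from 2q - 1 to 0: the shift at 2q - 1 vanishes, so the shift at 0 has to come
    entirely from the prefix. *)
Lemma tent_wrap :
  tent_shift 0 = - alpha ^+ (q - 1) /\
  tent_scale 0 = alpha * tent_scale (2 * q - 1) /\ tent_shift (2 * q - 1) = 0.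
Proof.
rewrite /tent_shift /tent_scale (_ : (0 < q - 1)%N); last by lia.
rewrite (_ : (2 * q - 1 < q - 1)%N = false); last by lia.
rewrite (_ : (2 * q - 1 == q - 1)%N = false); last by lia.
rewrite ltnn !mul1r -alphaXq; split=> //.
by rewrite alphaXq1; ring.
Qed.

(** The translation part of the loop at q - 1, divided by c; the term 1 is the weight of the prefix
    letter q. *)
Lemma tent_loop1 :
  1 - alpha * tent_shift (q - 1) = - tent_shift (q - 1).
Proof.
by rewrite /tent_shift ltnn eqxx -alphaXq alphaXq1; ring.
Qed.

End TentCoefficients.

Section TentRauzy.
Variables (R : realType) (alpha : R) (q : nat).
Hypotheses (q_ge2 : (2 <= q)%N) (alphaE : alpha ^+ (q - 1) * (alpha - 1) = 1).

(** The scalar c is the entry of nu at the letter 0. The entries recorded include those of all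
    letters in nonempty prefixes. *)
Lemma PF_theta (nu : 'rV[R]_(2 * q)) : PF_left_eigenvector (@theta q) alpha nu ->
  exists c, [/\ in_Qadj alpha c, c != 0 &
    forall b : 'I_(2 * q), (b = q - 1 :> nat \/ b = 2 * q - 1 :> nat)%N ->
      nu 0 b = alpha ^+ (q - 1) * c /\ nu 0 (ordS b) = c].
Proof.
move=> [nuE nu_gt0 Qnu].
have q0 : (0 < 2 * q)%N by lia.
have [|_ nubE] := @theta_eigenE q q_ge2 R alpha (nu 0) (Ordinal q0) erefl.
  by move=> b; rewrite -mul_incidence nuE mxE.
exists (nu 0 (Ordinal q0)); split; first exact: Qnu.
  by rewrite gt_eqF.
move=> b; rewrite (nubE b) (nubE (ordS b)) alphaE /= => -[] bE; rewrite bE.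
  rewrite modn_small; last by lia.
  rewrite (_ : (q - 1 < q)%N); last by lia.
  rewrite (_ : ((q - 1).+1 < q)%N = false); last by lia.
  by rewrite (_ : ((q - 1).+1 - q = 0)%N) ?mul1r; last by lia.
rewrite (_ : (2 * q - 1 < q)%N = false); last by lia.
rewrite (_ : ((2 * q - 1).+1 = 2 * q)%N); last by lia.
rewrite modnn (_ : (2 * q - 1 - q = q - 1)%N); last by lia.
by rewrite (_ : (0 < q)%N) ?mulr1 ?mul1r; last by lia.
Qed.

Section RauzyFamily.
Variables (r s : nat) (rs : r.-tuple R) (cs : s.-tuple R[i]).
Hypothesis enum : conj_enum alpha rs cs.
Variables (nu : 'rV[R]_(2 * q)) (c : R).
Hypotheses (Qc : in_Qadj alpha c)
  (nuE : forall b : 'I_(2 * q), (b = q - 1 :> nat \/ b = 2 * q - 1 :> nat)%N ->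
      nu 0 b = alpha ^+ (q - 1) * c /\ nu 0 (ordS b) = c).
Variable S : set (K R r s).
Hypothesis SE : S = affine alpha rs cs 0 alpha @` S `|`
                    affine alpha rs cs (alpha ^+ q) (- alpha ^+ q) @` S.

(* The sign reconciles the translation of the first branch of the substitution
   with that of X_0: tent_shift 0 = 1 - alpha^q = - alpha^(q-1), whereas the
   prefix of the letter 0 in theta (2q - 1) contributes + alpha^(q-1) c. *)
Let piece (k : nat) :=
  affine alpha rs cs (- c * tent_shift alpha q k) (- c * tent_scale alpha q k).

Let Qshift k : in_Qadj alpha (- c * tent_shift alpha q k).
Proof. by apply: in_QadjM; [exact: in_QadjN | exact: in_Qadj_tent_shift]. Qed.

Let Qscale k : in_Qadj alpha (- c * tent_scale alpha q k).
Proof. by apply: in_QadjM; [exact: in_QadjN | exact: in_Qadj_tent_scale]. Qed.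

Let special (a : 'I_(2 * q)) := (a = q - 1 :> nat \/ a = 2 * q - 1 :> nat)%N.

Let pieceL k x : piece k (affine alpha rs cs 0 alpha x) =
  affine alpha rs cs (- c * tent_shift alpha q k)
    (- c * (alpha * tent_scale alpha q k)) x.
Proof.
rewrite /piece.
rewrite (affine_comp enum _ (Qshift k) (Qscale k) (in_Qadj0 alpha)
  (in_Qadj_gen alpha)).
by congr affine; ring.
Qed.

Let pieceR k x :
  piece k (affine alpha rs cs (alpha ^+ q) (- alpha ^+ q) x) =
  affine alpha rs cs
    (- c * (tent_shift alpha q k + tent_scale alpha q k * alpha ^+ q))
    (- c * - (tent_scale alpha q k * alpha ^+ q)) x.
Proof.
have Qq := in_QadjX alpha q; rewrite /piece.
rewrite (affine_comp enum _ (Qshift k) (Qscale k) Qq (in_QadjN Qq)).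
by congr affine; ring.
Qed.

Let gmap_piece U k x : in_Qadj alpha (\sum_(b <- U) nu 0 b) ->
  gmap alpha nu rs cs U (piece k x) =
  affine alpha rs cs
    (\sum_(b <- U) nu 0 b - c * (alpha * tent_shift alpha q k))
    (- c * (alpha * tent_scale alpha q k)) x.
Proof.
move=> QU; rewrite (gmap_affine enum) /piece.
rewrite (affine_comp enum _ QU (in_Qadj_gen alpha) (Qshift k) (Qscale k)).
by congr affine; ring.
Qed.

Let ordS_val (b : 'I_(2 * q)) :
  b = (2 * q - 1)%N :> nat /\ ordS b = 0%N :> nat \/
  (b < 2 * q - 1)%N /\ ordS b = b.+1 :> nat.
Proof.
have lb := ltn_ord b; have [b1|b1] := eqVneq (nat_of_ord b) (2 * q - 1)%N.
  left; split=> //=; rewrite b1 (_ : ((2 * q - 1).+1 = 2 * q)%N) ?modnn //.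
  by lia.
by right; split; rewrite /= ?modn_small; lia.
Qed.

Let prefix (b : 'I_(2 * q)) :=
  if (b == 2 * q - 1 :> nat)%N then [:: b] else [::].

(** An ordinary letter occurs only once in the images of [theta], so one map carries the whole piece
    of its predecessor onto its own. *)
Let gmap_shift (b : 'I_(2 * q)) x : ~ special (ordS b) ->
  gmap alpha nu rs cs (prefix b) (piece b x) = piece (ordS b) x.
Proof.
rewrite /prefix /special; case: (ordS_val b) => -[bE SbE]; rewrite SbE => nsp.
  have [nu_b _] := nuE (or_intror bE).
  rewrite bE eqxx gmap_piece big_seq1 nu_b; last first.
    by apply: in_QadjM => //; exact: in_QadjX.
  have [w1 [w2 w3]] := tent_wrap q_ge2 alphaE.
  by rewrite /piece w1 w2 w3; congr affine; ring.
rewrite (_ : (b == _ :> nat) = false); last by lia.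
rewrite gmap_piece big_nil; last exact: in_Qadj0.
have [|//|w1 w2] := @tent_step R alpha q q_ge2 b; try by lia.
by rewrite /piece w1 w2; congr affine; ring.
Qed.

(** The two occurrences of q - 1 or 2q - 1 share out the set equation of the tile: the shift yields
    the f_R half, the loops below the f_L half. *)
Let gmap_shift_special (b : 'I_(2 * q)) x : special (ordS b) ->
  gmap alpha nu rs cs (prefix b) (piece b x) =
  piece (ordS b) (affine alpha rs cs (alpha ^+ q) (- alpha ^+ q) x).
Proof.
rewrite /prefix /special; case: (ordS_val b) => -[bE SbE]; rewrite SbE => sp.
  by lia.
rewrite (_ : (b == _ :> nat) = false); last by lia.
rewrite gmap_piece big_nil; last exact: in_Qadj0.
have [w1 w2] := @tent_step_special R alpha q q_ge2 b b.+1 erefl sp.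
by rewrite pieceR -w1 -w2 add0r -mulNr.
Qed.

Let gmap_loop1 (b : 'I_(2 * q)) x : b = (q - 1)%N :> nat ->
  gmap alpha nu rs cs [:: ordS b] (piece b x) =
  piece b (affine alpha rs cs 0 alpha x).
Proof.
move=> bE; have [_ nu_Sb] := nuE (or_introl bE).
rewrite gmap_piece big_seq1 nu_Sb // pieceL bE; congr affine.
by rewrite mulNr -mulrN -(tent_loop1 q_ge2 alphaE); ring.
Qed.

Let gmap_loop2 (b : 'I_(2 * q)) x : b = (2 * q - 1)%N :> nat ->
  gmap alpha nu rs cs [::] (piece b x) = piece b (affine alpha rs cs 0 alpha x).
Proof.
move=> bE; rewrite gmap_piece big_nil; last exact: in_Qadj0.
have [_ [_ w3]] := tent_wrap q_ge2 alphaE.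
by rewrite pieceL bE w3; congr affine; ring.
Qed.

Lemma tent_rauzy_equation (a : 'I_(2 * q)) :
  piece a @` S =
  \bigcup_(t in [set t : 'I_(2 * q) * seq 'I_(2 * q) * seq 'I_(2 * q) |
                  theta t.1.1 = t.1.2 ++ a :: t.2])
    gmap alpha nu rs cs t.1.2 @` (piece t.1.1 @` S).
Proof.
pose N U (b : 'I_(2 * q)) := gmap alpha nu rs cs U @` (piece b @` S).
suff -> : \bigcup_(t in [set t : 'I_(2 * q) * seq 'I_(2 * q) * seq 'I_(2 * q) |
                  theta t.1.1 = t.1.2 ++ a :: t.2]) N t.1.2 t.1.1 =
  [set x | exists b U, theta_occ b a U /\ N U b x].
  apply/seteqP; split=> x.
    case=> y Sy <-.
    have aE : ordS (ord_pred a) = a by rewrite ord_predK.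
    have pred_occ : theta_occ (ord_pred a) a (prefix (ord_pred a)).
      by have := ThetaShift (ord_pred a); rewrite aE.
    have [sp|nsp] := pselect (special a); last first.
      exists (ord_pred a), (prefix (ord_pred a)); split=> //.
      exists (piece (ord_pred a) y); first by exists y.
      by rewrite gmap_shift aE.
    (* A point of the f_L half is reached by a loop, a point of the f_R half from the
       predecessor. *)
    move: Sy; rewrite {1}SE => -[] [z Sz <-].
      case: (sp) => aE'.
        exists a, [:: ordS a]; split; first exact: ThetaLoop1.
        by exists (piece a z); [exists z | rewrite gmap_loop1].
      exists a, [::]; split; first exact: ThetaLoop2.
      by exists (piece a z); [exists z | rewrite gmap_loop2].
    exists (ord_pred a), (prefix (ord_pred a)); split=> //.
    exists (piece (ord_pred a) z); first by exists z.
    by rewrite gmap_shift_special aE.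
  case=> b [U [occ [_ [y Sy <-] <-]]].
  have SL : S (affine alpha rs cs 0 alpha y) by rewrite SE; left; exists y.
  have SR : S (affine alpha rs cs (alpha ^+ q) (- alpha ^+ q) y).
    by rewrite SE; right; exists y.
  case: occ => [|bE|bE].
  - have [sp|nsp] := pselect (special (ordS b)).
      by rewrite gmap_shift_special //; exact: imageP.
    by rewrite gmap_shift //; exact: imageP.
  - by rewrite gmap_loop1 //; exact: imageP.
  - by rewrite gmap_loop2 //; exact: imageP.
apply/seteqP; split=> x.
  case=> -[[b U] V] /= tb Nx; exists b, U; split=> //.
  by apply/(theta_occP q_ge2); exists V.
by case=> b [U [/(theta_occP q_ge2)[V tb] Nx]]; exists (b, U, V).
Qed.

End RauzyFamily.
Hypothesis alpha_gt1 : 1 < alpha.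

Lemma special_betaE : alpha / (alpha - 1) = alpha ^+ q.
Proof.
have a1 : alpha - 1 != 0 by rewrite subr_eq0 gt_eqF.
apply: (mulIf a1); rewrite divfK // (alphaXq alpha q_ge2) -mulrA alphaE mulr1 //.
Qed.

Section OneEnumeration.
Variables (r s : nat) (rs : r.-tuple R) (cs : s.-tuple R[i]).
Hypothesis enum : conj_enum alpha rs cs.

Lemma fR_affine_power x :
  fR alpha rs cs x = affine alpha rs cs (alpha ^+ q) (- alpha ^+ q) x.
Proof. by rewrite (fR_affine enum) special_betaE //; exact: in_QadjX. Qed.

Lemma X_affine (F : set (K R r s)) (k : 'I_(2 * q)) :
  X_ alpha rs cs F k =
  affine alpha rs cs (tent_shift alpha q k) (tent_scale alpha q k) @` F.
Proof.
have Q0 := in_Qadj0 alpha.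
have QX n : in_Qadj alpha (alpha ^+ n) by exact: in_QadjX.
have QM n : in_Qadj alpha (alpha ^+ n * alpha ^+ q) by exact: in_QadjM.
have iterE n x : (iter n (fL alpha rs cs) \o fR alpha rs cs) x =
    affine alpha rs cs (alpha ^+ n * alpha ^+ q)
      (- (alpha ^+ n * alpha ^+ q)) x.
  rewrite [LHS](iter_fL_affine enum) fR_affine_power.
  rewrite (affine_comp enum _ Q0 (QX n) (QX q) (in_QadjN (QX q))).
  by rewrite add0r mulrN.
rewrite /X_ /tent_shift /tent_scale.
case: ifP => k1.
  rewrite image_comp; apply: eq_imagel => x _.
  rewrite [LHS](congr1 (fun y => psi alpha rs cs (alpha ^+ k) - y) (iterE k x)).
  rewrite (psi_sub_affine enum _ (QX k) (QM k) (in_QadjN (QM k))).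
  by rewrite opprK mulrBr mulr1.
case: ifP => k2.
  rewrite image_comp; apply: eq_imagel => x _.
  rewrite /= (iter_fL_affine enum).
  by rewrite (psi_sub_affine enum _ (QX _) Q0 (QX _)) subr0.
case: ifP => k3; apply: eq_imagel => x _; first exact: iterE.
exact: (iter_fL_affine enum).
Qed.

End OneEnumeration.

End TentRauzy.

(** * The linear isomorphism and the proof of the theorem *)

Section ScaledTransport.
Variables (R : realType) (alpha c : R) (r s r' s' : nat).
Variables (rs : r.-tuple R) (cs : s.-tuple R[i]).
Variables (rs' : r'.-tuple R) (cs' : s'.-tuple R[i]).
Hypotheses (enum : conj_enum alpha rs cs) (enum' : conj_enum alpha rs' cs').
Hypotheses (Qc : in_Qadj alpha c) (c_neq0 : c != 0).

(** Transport accounts for the two enumerations, and the factor c for the choice of nu; the theorem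
    uses it with minus the scalar of [PF_theta]. *)
Definition scaled_transport (x : K R r s) : K R r' s' :=
  affine alpha rs' cs' 0 c (transport rs cs rs' cs' x).

Lemma scaled_transport_linear : linearK scaled_transport.
Proof.
move=> k x y; rewrite /scaled_transport transport_linear.
apply: K_eqP => i; rewrite !mxE.
  have [m m1 m2] := tnth_rs_conj enum' i.
  by rewrite (conj_img0 m1 m2) !add0r; ring.
have [m m1 m2] := tnth_cs_conj enum' i.
by rewrite (conj_img0 m1 m2) !add0r; ring.
Qed.

Lemma affine_continuous u v : continuous (affine alpha rs' cs' u v).
Proof.
apply: continuous_K => k.
  rewrite (_ : (fun x => _) = fun x : K R r' s' =>
    conj_img alpha (tnth rs' k) u + conj_img alpha (tnth rs' k) v * x.1 0 k).
    move=> x; apply: cvgD; first exact: cvg_cst.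
    by apply: cvgMl_tmp; exact: coord_continuous1.
  by apply/funext => x; rewrite affine1.
rewrite (_ : (fun x => _) = fun x : K R r' s' =>
  (conj_img alpha (tnth cs' k) u +
   conj_img alpha (tnth cs' k) v * x.2 0 k) : R[i]^o).
  move=> x; apply: cvgD; first exact: cvg_cst.
  exact: (cvgZl_tmp (@coord_continuous2 R r' s' k x)).
by apply/funext => x; rewrite affine2.
Qed.

Lemma scaled_transport_bijective : bijective scaled_transport.
Proof.
(* Dividing by the nonzero conjugates of c avoids having to show that the inverse of c lies in
   Q(alpha). *)
pose inv_mul (x : K R r' s') : K R r' s' :=
  (\row_i ((conj_img alpha (tnth rs' i) c)^-1 * x.1 0 i),
   \row_j ((conj_img alpha (tnth cs' j) c)^-1 * x.2 0 j)).
exists (transport rs' cs' rs cs \o inv_mul).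
  move=> x /=; rewrite -[RHS](transportK enum enum'); congr transport.
  apply: K_eqP => i; rewrite !mxE.
    have [m m1 m2] := tnth_rs_conj enum' i.
    by rewrite (conj_img0 m1 m2) add0r mulKf // (conj_img_neq0 m1 m2).
  have [m m1 m2] := tnth_cs_conj enum' i.
  by rewrite (conj_img0 m1 m2) add0r mulKf // (conj_img_neq0 m1 m2).
move=> x; rewrite /scaled_transport /= (transportK enum' enum).
apply: K_eqP => i; rewrite !mxE.
  have [m m1 m2] := tnth_rs_conj enum' i.
  by rewrite (conj_img0 m1 m2) add0r mulVKf // (conj_img_neq0 m1 m2).
have [m m1 m2] := tnth_cs_conj enum' i.
by rewrite (conj_img0 m1 m2) add0r mulVKf // (conj_img_neq0 m1 m2).
Qed.

Lemma scaled_transport_affine u v x : in_Qadj alpha u -> in_Qadj alpha v ->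
  scaled_transport (affine alpha rs cs u v x) =
  affine alpha rs' cs' (c * u) (c * v) (transport rs cs rs' cs' x).
Proof.
move=> Qu Qv; rewrite /scaled_transport (transport_affine enum enum').
by rewrite (affine_comp enum') ?add0r //; exact: in_Qadj0.
Qed.

End ScaledTransport.

Theorem theorem4p3 (R : realType) (alpha : R) (q : nat)
    (spu : special_pisot_unit alpha)
    (q_ge2 : (2 <= q)%N)
    (alpha_q : alpha ^+ q = alpha / (alpha - 1)) :
  [/\ nonerasing (@theta q), primitive (@theta q), unimodular (@theta q),
      pisot_subst (@theta q) R & dominant_root (@theta q) alpha] /\
  (forall (r s : nat) (rs : r.-tuple R) (cs : s.-tuple R[i])
      (F : set (K R r s)),
    conj_enum alpha rs cs -> tent_tile alpha rs cs F ->
   forall (r' s' : nat) (rs' : r'.-tuple R) (cs' : s'.-tuple R[i])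
      (nu : 'rV[R]_(2 * q)),
    conj_enum alpha rs' cs' -> PF_left_eigenvector (@theta q) alpha nu ->
    exists Phi : K R r s -> K R r' s',
      [/\ linearK Phi, bijective Phi &
          unique (rauzy_family (@theta q) alpha nu rs' cs')
                 (fun k => Phi @` X_ alpha rs cs F k)]).
Proof.
have [pisot_alpha _ _] := spu.
have [_ alpha_gt1 _] := pisot_alpha.
have alphaE : alpha ^+ (q - 1) * (alpha - 1) = 1.
  have a0 : alpha != 0 by rewrite gt_eqF // (lt_trans ltr01).
  have a1 : alpha - 1 != 0 by rewrite subr_eq0 gt_eqF.
  by apply: (mulfI a0); rewrite mulrA -alphaXq // alpha_q divfK ?mulr1.
have dom := dominant_root_theta q_ge2 alpha_gt1 alphaE.
split.
  split=> //; [exact: nonerasing_theta | exact: primitive_theta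
              | exact: unimodular_theta | by exists alpha].
move=> r s rs cs F enum [F_neq0 F_compact FE] r' s' rs' cs' nu enum' PF.
have [c [Qc c_neq0 nuE]] := PF_theta q_ge2 alphaE PF.
pose T := transport rs cs rs' cs'.
pose Phi := scaled_transport alpha (- c) rs cs rs' cs'.
have PhiX (k : 'I_(2 * q)) : Phi @` X_ alpha rs cs F k =
    affine alpha rs' cs' (- c * tent_shift alpha q k)
      (- c * tent_scale alpha q k) @` (T @` F).
  rewrite (X_affine q_ge2 alphaE alpha_gt1 enum) !image_comp.
  apply: eq_imagel => x _ /=; apply: scaled_transport_affine => //.
  - exact: in_QadjN.
  - exact: in_Qadj_tent_shift.
  - exact: in_Qadj_tent_scale.
(* The transported tile solves the tent equation in the target coordinates, so [tent_rauzy_equation]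
   applies there. *)
have TF : T @` F = affine alpha rs' cs' 0 alpha @` (T @` F) `|`
    affine alpha rs' cs' (alpha ^+ q) (- alpha ^+ q) @` (T @` F).
  rewrite {1}FE image_setU.
  congr (_ `|` _); rewrite [LHS]image_comp [RHS]image_comp.
    apply: eq_imagel => x _.
    by rewrite /= (fL_affine enum) /T (transport_affine enum enum').
  apply: eq_imagel => x _ /=.
  by rewrite (fR_affine_power q_ge2 alphaE alpha_gt1 enum) /T
             (transport_affine enum enum').
have famPhi : rauzy_family (@theta q) alpha nu rs' cs'
    (fun k => Phi @` X_ alpha rs cs F k).
  move=> a; split.
  - by rewrite PhiX; do 2![apply/image_nonempty].
  - rewrite PhiX; apply: compact_image; first exact: affine_continuous.
    by apply: compact_image => //; exact: transport_continuous.
  - rewrite PhiX (tent_rauzy_equation q_ge2 alphaE enum' Qc nuE TF).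
    by apply: eq_bigcupr => t _; rewrite PhiX.
exists Phi; split.
- exact: scaled_transport_linear.
- by apply: scaled_transport_bijective; rewrite ?oppr_eq0 //; exact: in_QadjN.
split=> // Y famY; apply: rauzy_family_unique famPhi famY => k.
- exact: (tnth_rs_lt1 enum').
- exact: (tnth_cs_lt1 enum').
Qed.
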